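(* Let $z\in\mathbb{C}^n$, $\tilde z=[z^T,1]^T\in\mathbb{C}^{n+1}$, and for $i=1,\dots,m$ let $(\mu_{d_i},\Gamma_{d_i},J_{d_i})$ be the prescribed mean, covariance and pseudo-covariance of $d_i$. For any $p_i\in(0,1)$, the distributionally robust complex chance constraint $$\inf_{d_i\sim(\mu_{d_i},\Gamma_{d_i},J_{d_i})}\mathbb{P}[\mathrm{Re}(d_i\tilde z)\le 0]\ge p_i,\qquad i=1,\dots,m,$$ is equivalent to $$k_{p_i}\,\sigma_{\varphi_i(z)}+\mu_{\varphi_i(z)}\le 0,\qquad k_{p_i}=\sqrt{p_i/(1-p_i)},\qquad i=1,\dots,m,$$ with $\varphi_i(z)=\mathrm{Re}(d_i\tilde z)$. Moreover, for individual chance constraints (each $p_i\in(0,1)$ a fixed constant), the latter constraint is a convex second-order cone constraint in $z$.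
   Context: Here $d_i\sim(\mu_{d_i},\Gamma_{d_i},J_{d_i})$ means that the distribution of the random vector $d_i$ ranges over the (nonempty) family of all probability distributions on $\mathbb{C}^{n+1}$ with mean $\mu_{d_i}$, covariance matrix $\Gamma_{d_i}$ (entries $\mathrm{Cov}((d_i)_j,(d_i)_k)=\mathbb{E}[((d_i)_j-\mathbb{E}(d_i)_j)\overline{((d_i)_k-\mathbb{E}(d_i)_k)}]$) and pseudo-covariance matrix $J_{d_i}$ (entries $\mathbb{E}[((d_i)_j-\mathbb{E}(d_i)_j)((d_i)_k-\mathbb{E}(d_i)_k)]$). The product $d_i\tilde z=\sum_j(d_i)_j\tilde z_j$ is without conjugation. $\mu_{\varphi_i(z)}$ and $\sigma_{\varphi_i(z)}\ge0$ are the mean and standard deviation of $\varphi_i(z)$; they are the same for every distribution in the family. A convex second-order cone constraint in $z$ is one of the form $\|Mx+q\|\le f^Tx+g$ with $x=(\mathrm{Re}(z),\mathrm{Im}(z))$. *)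

(* Defs.v *)
From HB Require Import structures.
From mathcomp Require Import all_boot all_order all_algebra.
From mathcomp Require Import complex.
From mathcomp Require Import all_classical all_reals all_analysis.

Set Implicit Arguments.
Unset Strict Implicit.
Unset Printing Implicit Defensive.

Import Order.TTheory GRing.Theory Num.Theory.

Local Open Scope classical_set_scope.
Local Open Scope ring_scope.
Local Open Scope complex_scope.

HB.instance Definition _ (R : realType) := isPointed.Build R[i] 0.

Definition re_coord (R : realType) (n : nat) (j : 'I_n) (d : 'rV[R[i]]_n) : R :=
  complex.Re (d 0 j).
Definition im_coord (R : realType) (n : nat) (j : 'I_n) (d : 'rV[R[i]]_n) : R :=
  complex.Im (d 0 j).

(* Sets depending on one real coordinate, through a Borel subset of R: they
   generate the Borel sigma-algebra of C^n = R^(2n). *)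
Definition coord_sets (R : realType) (n : nat) : set (set 'rV[R[i]]_n) :=
  \bigcup_(j in [set: 'I_n])
    (preimage_set_system setT (@re_coord R n j) measurable `|`
     preimage_set_system setT (@im_coord R n j) measurable).

Definition borelCrow (R : realType) (n : nat) :=
  g_sigma_algebraType (@coord_sets R n).

Notation Cdistribution R n := (probability (borelCrow R n) R).

(* Meaningful only when the real and imaginary parts of X are integrable. *)
Definition Cexpectation (R : realType) (n : nat) (P : Cdistribution R n)
    (X : 'rV[R[i]]_n -> R[i]) : R[i] :=
  fine 'E_P[fun d => complex.Re (X d)] +i* fine 'E_P[fun d => complex.Im (X d)].

Definition Cmean (R : realType) (n : nat) (P : Cdistribution R n) :
    'rV[R[i]]_n :=
  \row_j Cexpectation P (fun d => d 0 j).

Definition Ccovariance (R : realType) (n : nat) (P : Cdistribution R n) :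
    'M[R[i]]_n :=
  \matrix_(j, k) Cexpectation P
    (fun d => (d 0 j - Cmean P 0 j) * conjc (d 0 k - Cmean P 0 k)).

Definition Cpseudo_covariance (R : realType) (n : nat)
    (P : Cdistribution R n) : 'M[R[i]]_n :=
  \matrix_(j, k) Cexpectation P
    (fun d => (d 0 j - Cmean P 0 j) * (d 0 k - Cmean P 0 k)).

(* Square integrability of the coordinates is what makes the mean, the
   covariance and the pseudo-covariance well defined. *)
Definition distributions_with (R : realType) (n : nat) (mu : 'rV[R[i]]_n)
    (Gamma J : 'M[R[i]]_n) : set (Cdistribution R n) :=
  [set P : Cdistribution R n | [/\ forall j : 'I_n,
                 (re_coord j : borelCrow R n -> R) \in Lfun P 2%:E /\
                 (im_coord j : borelCrow R n -> R) \in Lfun P 2%:E,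
               Cmean P = mu,
               Ccovariance P = Gamma &
               Cpseudo_covariance P = J]].

Definition ztilde (R : realType) (n : nat) (z : 'cV[R[i]]_n) :
    'cV[R[i]]_(n + 1) :=
  col_mx z (const_mx 1).

Definition phi (R : realType) (n : nat) (z : 'cV[R[i]]_n)
    (d : 'rV[R[i]]_(n + 1)) : R :=
  complex.Re ((d *m ztilde z) 0 0).

Definition robust_chance_constraint (R : realType) (n : nat)
    (mu : 'rV[R[i]]_(n + 1)) (Gamma J : 'M[R[i]]_(n + 1)) (p : R)
    (z : 'cV[R[i]]_n) : Prop :=
  (p%:E <= ereal_inf
             [set (P : Cdistribution R (n + 1)) [set d | (phi z d <= 0)%R]
             | P in distributions_with mu Gamma J])%E.

Definition kfactor (R : realType) (p : R) : R := Num.sqrt (p / (1 - p)).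

(* The Euclidean norm; the library's norm on matrices is the sup norm. *)
Definition l2norm (R : realType) (r : nat) (v : 'cV[R]_r) : R :=
  Num.sqrt (\sum_i v i 0 ^+ 2).

Definition realify (R : realType) (n : nat) (z : 'cV[R[i]]_n) :
    'cV[R]_(n + n) :=
  col_mx (map_mx (@complex.Re R) z) (map_mx (@complex.Im R) z).

(* The constraint c z <= 0 is of the form ||M x + q|| <= f^T x + g: we ask for
   equality of the constraint functions, not only of the feasible sets. *)
Definition is_soc_constraint (R : realType) (n : nat)
    (c : 'cV[R[i]]_n -> R) : Prop :=
  exists (r : nat) (M : 'M[R]_(r, n + n)) (q : 'cV[R]_r)
         (f : 'cV[R]_(n + n)) (g : R),
    forall z, c z = l2norm (M *m realify z + q)
                    - ((f^T *m realify z) 0 0 + g).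

(* Main.v *)
(* Write d as the real vector of its real and imaginary coordinates. The triple
   (mu, Gamma, J) determines its mean and covariance, so phi_z, which is a linear
   combination of these coordinates, has a mean m and a standard deviation s
   common to the whole family.

   If k s + m <= 0, Cantelli's inequality gives P(phi_z > 0) <= 1 - p.
   Conversely, let k s + m > 0. If s = 0, then phi_z = m > 0 almost surely.
   Otherwise choose 0 < t < k with m + s t > 0. Starting from any member of the
   family, keep the component of d that is uncorrelated with phi_z and replace
   phi_z by the value m - s / t with probability t^2 / (1 + t^2) and by m + s t
   otherwise: first and second moments are unchanged, while
   P(phi_z <= 0) <= t^2 / (1 + t^2) < p.

   The constraint is conic because a positive semidefinite form is a sum of
   squares of linear forms, and the weights of phi_z are affine in
   (Re z, Im z). *)

Require Import Defs.
From HB Require Import structures.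
From mathcomp Require Import all_boot all_order all_algebra.
From mathcomp Require Import complex.
From mathcomp Require Import all_classical all_reals all_analysis measurable_realfun.
From mathcomp Require Import ring lra.

Set Implicit Arguments.
Unset Strict Implicit.
Unset Printing Implicit Defensive.

Import Order.TTheory GRing.Theory Num.Theory.

Local Open Scope classical_set_scope.
Local Open Scope ring_scope.

(** * Positive semidefinite forms as sums of squares of linear forms *)

Section psd_factorization.
Context (R : realType) (I : finType).
Implicit Types (S : I -> I -> R) (w : I -> R).

Definition qform S w := \sum_a \sum_b w a * w b * S a b.

(** Perturbing a single coordinate serves twice: started from zero, it evaluates the form on vectors
    supported on one or two indices; in the elimination below, it completes the square. *)
Lemma qform_shift S w a0 t : (forall a b, S a b = S b a) ->
  qform S (fun a => w a + (a == a0)%:R * t) =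
  qform S w + 2 * t * (\sum_a w a * S a a0) + t ^+ 2 * S a0 a0.
Proof.
move=> Ssym; rewrite /qform.
have delta (F : I -> R) : \sum_b (b == a0)%:R * F b = F a0.
  rewrite (bigD1 a0)//= eqxx mul1r big1 ?addr0// => b /negPf ->.
  by rewrite mul0r.
under eq_bigr => a _.
  rewrite (_ : \sum_b _ = \sum_b w a * w b * S a b + w a * (t * S a a0) +
     (a == a0)%:R * (t * (\sum_b w b * S a b) + t ^+ 2 * S a a0)); last first.
    rewrite -[in RHS](delta (fun b => t * S a b)).
    rewrite -[in X in _ = _ + _ * (_ + X)](delta (fun b => t ^+ 2 * S a b)).
    rewrite 2!mulr_sumr mulrDr mulr_sumr mulr_sumr -!big_split/=.
    by apply: eq_bigr => b _; ring.
  over.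
rewrite !big_split/= delta.
rewrite addrA; congr (_ + _); rewrite -addrA; congr (_ + _).
under [X in t * X]eq_bigr do rewrite Ssym.
rewrite !mulr_sumr -big_split/=; apply: eq_bigr => a _; ring.
Qed.

Lemma psd_diag_ge0 S a : (forall a b, S a b = S b a) ->
  (forall w, 0 <= qform S w) -> 0 <= S a a.
Proof.
move=> Ssym /(_ (fun b => 0 + (b == a)%:R * 1)).
rewrite qform_shift// /qform big1 => [|b _]; last first.
  by rewrite big1// => c _; rewrite !mul0r.
by rewrite big1 => [|b _]; rewrite ?mul0r// mulr0 !add0r expr1n mul1r.
Qed.

(** On the vector with entry 1 at [b] and [t] at [a], the form reduces to [2 * t * S b a]. This is
    linear in [t], so nonnegativity at [t = 1] and [t = -1] forces the coefficient to vanish. *)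
Lemma psd_off_diag0 S a b : (forall a b, S a b = S b a) ->
  (forall w, 0 <= qform S w) -> S a a = 0 -> S b b = 0 -> S a b = 0.
Proof.
move=> Ssym Spsd Saa Sbb.
have E t : 0 <= 2 * t * S b a.
  have := Spsd (fun c => (0 + (c == b)%:R * 1) + (c == a)%:R * t).
  rewrite !qform_shift// Saa Sbb !mulr0 !addr0 /qform big1; last first.
    by move=> c _; rewrite big1// => d _; rewrite !mul0r.
  rewrite big1 => [|c _]; last by rewrite mul0r.
  rewrite mulr0 !add0r (bigD1 b)//= eqxx big1 => [|c /negPf ->].
    by rewrite add0r !mul1r addr0.
  by rewrite !(mul0r, add0r).
by have := E 1; have := E (-1); rewrite (Ssym a b); lra.
Qed.

(* Cholesky elimination: subtracting the square of one column at a pivot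
   [S a a != 0] kills that diagonal entry and creates no new nonzero one. *)
Lemma psd_sum_squares S : (forall a b, S a b = S b a) ->
  (forall w, 0 <= qform S w) ->
  exists s : seq (I -> R), forall w,
    qform S w = \sum_(l <- s) (\sum_a w a * l a) ^+ 2.
Proof.
(* Induction on a bound for the number of nonzero diagonal entries. *)
move: {2}#|_| (leqnn #|[pred a | S a a != 0]|) => k.
elim: k S => [|k IH] S Sk Ssym Spsd.
  exists [::] => w; rewrite big_nil /qform big1// => a _; rewrite big1// => b _.
  have S0 c : S c c = 0.
    move: Sk; rewrite leqn0 => /eqP/card0_eq/(_ c).
    by rewrite !inE => /negbFE/eqP.
  by rewrite (psd_off_diag0 Ssym Spsd)// mulr0.
have [a0 /= Sa0|S0] := pickP (fun a => S a a != 0); last first.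
  by apply: (IH S) => //; rewrite eq_card0.
have Sa0_gt0 : 0 < S a0 a0 by rewrite lt_neqAle eq_sym Sa0 psd_diag_ge0.
pose S' b c := S b c - S b a0 * S c a0 / S a0 a0.
have qS' w : qform S' w = qform S w - (\sum_b w b * S b a0) ^+ 2 / S a0 a0.
  rewrite /qform expr2 mulr_suml mulr_suml -sumrB; apply: eq_bigr => a _.
  rewrite mulrAC mulr_sumr -sumrB; apply: eq_bigr => b _.
  by rewrite /S'; ring.
have S'sym a b : S' a b = S' b a by rewrite /S' Ssym [_ * S b a0]mulrC.
have S'psd w : 0 <= qform S' w.
  rewrite qS'.
  (* This shift minimises [qform S] along the coordinate [a0], and the minimum is exactly
     [qform S' w]. *)
  have := Spsd (fun a => w a + (a == a0)%:R * - ((\sum_b w b * S b a0) / S a0 a0)).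
  rewrite qform_shift//; set x := \sum_b _; congr (0 <= _); field => //.
have [|s Hs] := IH S' _ S'sym S'psd.
  rewrite -ltnS (leq_trans _ Sk)//; apply: proper_card; apply/properP; split.
    (* If [S b b = 0], then [S' b b] is minus a square over the positive pivot, hence nonpositive;
       positivity of [S'] makes it zero. *)
    apply/fintype.subsetP => b; rewrite !inE; apply: contra_neq => Sb.
    have := psd_diag_ge0 b S'sym S'psd; rewrite /S' Sb.
    have : 0 <= S b a0 * S b a0 / S a0 a0 by rewrite divr_ge0 -?expr2 ?sqr_ge0 ?(ltW Sa0_gt0).
    by lra.
  by exists a0; rewrite !inE ?Sa0// /S' mulfK ?subrr ?eqxx.
exists ((fun b => S b a0 / Num.sqrt (S a0 a0)) :: s) => w.
rewrite big_cons -Hs qS'.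
rewrite (_ : (\sum_a _) ^+ 2 = (\sum_b w b * S b a0) ^+ 2 / S a0 a0); first by ring.
under eq_bigr do rewrite mulrA.
by rewrite -mulr_suml expr_div_n sqr_sqrtr// ltW.
Qed.

End psd_factorization.

(** * Real-valued means and covariances of square-integrable variables *)

Section real_moments.
Context d (T : measurableType d) (R : realType) (P : probability T R).
Implicit Types (f g X Y : T -> R).

(** [fine] sends infinite values to 0, so the algebraic laws below ask for integrability. *)
Definition mean X : R := fine ('E_P[X])%E.
Definition cov X Y : R := mean (fun x => (X x - mean X) * (Y x - mean Y)).

Lemma meanE X : X \in Lfun P 1 -> ('E_P[X] = (mean X)%:E)%E.
Proof. by move=> X1; rewrite /mean fineK// expectation_fin_num. Qed.

Lemma eq_mean X Y : X =1 Y -> mean X = mean Y.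
Proof. by move=> XY; congr mean; apply/funext. Qed.

Lemma mean_cst r : mean (fun _ => r) = r.
Proof. by rewrite /mean expectation_cst. Qed.

Lemma Lfun2_Lfun1 X : X \in Lfun P 2%:E -> X \in Lfun P 1.
Proof. by apply: Lfun_subset12; exact: fin_num_measure. Qed.

Lemma Lfun2_prod X Y : X \in Lfun P 2%:E -> Y \in Lfun P 2%:E ->
  (fun x => X x * Y x) \in Lfun P 1.
Proof. exact: Lfun2_mul_Lfun1. Qed.

Lemma LfunD (p : R) X Y : 1 <= p -> X \in Lfun P p%:E -> Y \in Lfun P p%:E ->
  (fun x => X x + Y x) \in Lfun P p%:E.
Proof. by move=> p1 X2 Y2; exact: rpredD. Qed.

Lemma LfunZ (p c : R) X : 1 <= p -> X \in Lfun P p%:E ->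
  (fun x => c * X x) \in Lfun P p%:E.
Proof.
move=> p1 X2; rewrite (_ : (fun _ => _) = c \o* X) ?Lfun_scale//.
by apply/funext => x; rewrite /= mulrC.
Qed.

Lemma Lfun_const (p c : R) : (fun=> c) \in Lfun P p%:E.
Proof. exact: Lfun_cst. Qed.

Lemma Lfun_sum (p : R) (I : Type) (s : seq I) (F : I -> T -> R) : 1 <= p ->
  (forall i, F i \in Lfun P p%:E) ->
  (fun x => \sum_(i <- s) F i x) \in Lfun P p%:E.
Proof.
move=> p1 F1; elim: s => [|i s IH].
  under eq_fun do rewrite big_nil; exact: Lfun_const.
by under eq_fun do rewrite big_cons; exact: LfunD.
Qed.

Lemma meanD X Y : X \in Lfun P 1 -> Y \in Lfun P 1 ->
  mean (fun x => X x + Y x) = mean X + mean Y.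
Proof.
by move=> X1 Y1; rewrite /mean expectationD// fineD// expectation_fin_num.
Qed.

Lemma meanZ c X : X \in Lfun P 1 -> mean (fun x => c * X x) = c * mean X.
Proof.
move=> X1; rewrite /mean (_ : (fun _ => _) = c \o* X).
  by rewrite expectationZl// fineM// expectation_fin_num.
by apply/funext => x; rewrite /= mulrC.
Qed.

Lemma mean_sum (I : Type) (s : seq I) (F : I -> T -> R) :
  (forall i, F i \in Lfun P 1) ->
  mean (fun x => \sum_(i <- s) F i x) = \sum_(i <- s) mean (F i).
Proof.
move=> F1; elim: s => [|i s IH].
  by under eq_fun do rewrite big_nil; rewrite big_nil mean_cst.
under eq_fun do rewrite big_cons.
by rewrite meanD// ?IH ?big_cons//; exact: Lfun_sum.
Qed.

Lemma Lfun2_center X c : X \in Lfun P 2%:E -> (fun x => X x - c) \in Lfun P 2%:E.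
Proof. by move=> X2; apply: LfunD; rewrite ?ler1n// Lfun_const. Qed.

Lemma varianceE_cov X : X \in Lfun P 2%:E -> variance P X = (cov X X)%:E.
Proof.
move=> X2; rewrite /variance unlock meanE//.
apply: Lfun2_mul_Lfun1; exact: Lfun2_center.
Qed.

Lemma covC X Y : cov X Y = cov Y X.
Proof. by apply: eq_mean => x; rewrite mulrC. Qed.

Lemma mean_lin (I : finType) (X : I -> T -> R) (w : I -> R) :
  (forall a, X a \in Lfun P 1) ->
  mean (fun x => \sum_a w a * X a x) = \sum_a w a * mean (X a).
Proof.
move=> X1; rewrite mean_sum => [|a]; last exact: LfunZ.
by apply: eq_bigr => a _; rewrite meanZ.
Qed.

Lemma cov_linr (I : finType) (X : I -> T -> R) (w : I -> R) Y :
  (forall a, X a \in Lfun P 2%:E) -> Y \in Lfun P 2%:E ->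
  cov Y (fun x => \sum_a w a * X a x) = \sum_a w a * cov Y (X a).
Proof.
move=> X2 Y2; rewrite /cov mean_lin => [|a]; last exact/Lfun2_Lfun1.
rewrite -(@mean_lin _ (fun a x => (Y x - mean Y) * (X a x - mean (X a)))).
  2: by move=> a; apply: Lfun2_prod; exact: Lfun2_center.
apply: eq_mean => x; rewrite -sumrB mulr_sumr.
by apply: eq_bigr => a _; ring.
Qed.

Lemma cov_lin (I : finType) (X : I -> T -> R) (w : I -> R) :
  (forall a, X a \in Lfun P 2%:E) ->
  cov (fun x => \sum_a w a * X a x) (fun x => \sum_a w a * X a x) =
  \sum_a \sum_b w a * w b * cov (X a) (X b).
Proof.
move=> X2; rewrite cov_linr//; last first.
  by apply: Lfun_sum => [|a]; rewrite ?ler1n//; apply: LfunZ; rewrite ?ler1n.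
apply: eq_bigr => a _; rewrite covC cov_linr// mulr_sumr.
by apply: eq_bigr => b _; ring.
Qed.

Lemma cov_ge0 X : 0 <= cov X X.
Proof. by apply/fine_ge0/expectation_ge0 => x; rewrite -expr2 sqr_ge0. Qed.

(** Reduces membership in L2 to the integral of a square, which the mixture and pushforward formulas
    can handle. *)
Lemma Lfun2P X : measurable_fun setT X ->
  P.-integrable setT (fun x => (X x ^+ 2)%:E) -> X \in Lfun P 2%:E.
Proof.
move=> mX /integrableP[_ iX]; rewrite inE; apply/andP; split; rewrite inE//=.
rewrite /finite_norm unlock poweR_lty//; apply: le_lt_trans iX.
apply: ge0_le_integral => //.
- by move=> x _; rewrite lee_fin powR_ge0.
- apply/measurable_EFinP/(@measurableT_comp _ _ _ _ _ _ (fun x : R => x `^ 2)) => //.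
  exact: measurableT_comp.
- apply: measurableT_comp => //; apply/measurable_EFinP; exact: measurable_funX.
- move=> x _; rewrite /= lee_fin powR_mulrn// real_normK ?num_real//.
  by rewrite ler_norm.
Qed.

Lemma Lfun_measurable p X : X \in Lfun P p -> measurable_fun setT X.
Proof. by move=> /sub_Lfun_mfun /set_mem. Qed.

End real_moments.

(** * Convex combinations of two probability measures *)

Section mixture.
Context d (T : measurableType d) (R : realType).
Variables (q : R) (q01 : 0 <= q <= 1) (P Q : probability T R).

Let q0 : 0 <= q. Proof. by case/andP: q01. Qed.
Let q1 : 0 <= 1 - q. Proof. by rewrite subr_ge0; case/andP: q01. Qed.

Definition mixture : set T -> \bar R :=
  measure_add (mscale (NngNum q0) P) (mscale (NngNum q1) Q).

HB.instance Definition _ := Measure.on mixture.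

Lemma mixtureE A : mixture A = (q%:E * P A + (1 - q)%:E * Q A)%E.
Proof. exact: measure_addE. Qed.

Let mixture_setT : mixture setT = 1%E.
Proof. by rewrite mixtureE !probability_setT !mule1 -EFinD subrKC. Qed.

HB.instance Definition _ :=
  @Measure_isProbability.Build _ _ R mixture mixture_setT.

Lemma ge0_integral_mixture (f : T -> \bar R) : measurable_fun setT f ->
  (forall x, 0 <= f x)%E ->
  (\int[mixture]_x f x = q%:E * \int[P]_x f x + (1 - q)%:E * \int[Q]_x f x)%E.
Proof.
move=> mf f0; rewrite ge0_integral_measure_add//.
by congr (_ + _)%E; rewrite ge0_integral_mscale.
Qed.

(** The nonnegative case applies to the positive and negative parts. Integrability makes the four
    resulting integrals finite, which turns the claim into an identity between reals. *)
Lemma integral_mixture (f : T -> \bar R) : P.-integrable setT f ->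
  Q.-integrable setT f ->
  (\int[mixture]_x f x = q%:E * \int[P]_x f x + (1 - q)%:E * \int[Q]_x f x)%E.
Proof.
move=> Pf Qf; have mf := measurable_int _ Pf.
rewrite [LHS]integralE (integralE P) (integralE Q).
rewrite 2?ge0_integral_mixture//; try exact: measurable_funepos;
  try exact: measurable_funeneg.
have [Pp Pn] := (integrable_funepos measurableT Pf, integrable_funeneg measurableT Pf).
have [Qp Qn] := (integrable_funepos measurableT Qf, integrable_funeneg measurableT Qf).
move: (integrable_fin_num measurableT Pp) (integrable_fin_num measurableT Pn).
move: (integrable_fin_num measurableT Qp) (integrable_fin_num measurableT Qn).
move: (\int[P]_x _)%E (\int[P]_x _)%E (\int[Q]_x _)%E (\int[Q]_x _)%E.
move=> [a| |] [b| |] [c| |] [e| |]//= _ _ _ _; congr EFin; ring.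
Qed.

Lemma integrable_mixture (f : T -> \bar R) : P.-integrable setT f ->
  Q.-integrable setT f -> mixture.-integrable setT f.
Proof.
move=> Pf Qf; have mf := measurable_int _ Pf.
apply/integrableP; split => //; rewrite ge0_integral_mixture//; last first.
  exact: measurableT_comp.
have Pi := integrable_fin_num measurableT (integrable_abse Pf).
have Qi := integrable_fin_num measurableT (integrable_abse Qf).
by rewrite ltey_eq fin_numD !fin_numM.
Qed.

Lemma mean_mixture (X : T -> R) : X \in Lfun P 1 -> X \in Lfun Q 1 ->
  mean mixture X = q * mean P X + (1 - q) * mean Q X.
Proof.
move=> /Lfun1_integrable XP /Lfun1_integrable XQ.
rewrite /mean unlock integral_mixture//.
move: (integrable_fin_num measurableT XP) (integrable_fin_num measurableT XQ).
by move: (\int[P]_x _)%E (\int[Q]_x _)%E => [a| |] [b| |].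
Qed.

Lemma Lfun2_mixture (X : T -> R) : X \in Lfun P 2%:E -> X \in Lfun Q 2%:E ->
  X \in Lfun mixture 2%:E.
Proof.
move=> XP XQ; apply: Lfun2P; first exact: Lfun_measurable XP.
by apply: integrable_mixture; exact: Lfun2_integrable_sqr.
Qed.

End mixture.

(** * Moments of image measures *)

Section pushforward.
Context d d' (T : measurableType d) (T' : measurableType d') (R : realType).
Variables (P : probability T R) (f : {mfun T >-> T'}).

Lemma Lfun2_pushforward (X : T' -> R) : measurable_fun setT X ->
  X \o f \in Lfun P 2%:E -> X \in Lfun (distribution P f) 2%:E.
Proof.
move=> mX Xf; apply: Lfun2P => //; apply: integrable_pushforward => //.
  by apply/measurable_EFinP; exact: measurable_funX.
exact: (Lfun2_integrable_sqr Xf).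
Qed.

Lemma mean_pushforward (X : T' -> R) : measurable_fun setT X ->
  X \o f \in Lfun P 1 -> mean (distribution P f) X = mean P (X \o f).
Proof.
move=> mX Xf; rewrite /mean unlock integral_distribution//.
  exact/measurable_EFinP.
exact/Lfun1_integrable.
Qed.

End pushforward.

(** * Cantelli bounds and the degenerate case of zero variance *)

Section one_sided_bounds.
Context d (T : measurableType d) (R : realType) (P : probability T R).
Variables (X : T -> R) (X2 : X \in Lfun P 2%:E).

Let mX : measurable_fun setT X := Lfun_measurable X2.
Let X1 : X \in Lfun P 1 := Lfun2_Lfun1 X2.

Lemma cantelli_mean lambda : 0 < lambda ->
  (P [set x | (lambda <= X x - mean P X)%R] <=
   (cov P X X / (cov P X X + lambda ^+ 2))%:E)%E.
Proof.
move=> l0; pose Y : {mfun T >-> R} := mfun_Sub (mem_set mX).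
have := @cantelli _ T R P Y lambda X2 l0.
rewrite /= (meanE X1) (varianceE_cov X2)/=.
by under eq_set do rewrite -EFinB lee_fin.
Qed.

Lemma measurable_gt0 : measurable [set x | 0 < X x].
Proof.
rewrite (_ : [set _ | _] = X @^-1` `]0, +oo[).
  by rewrite -[X in measurable X]setTI; exact: mX.
by apply/seteqP; split => x /=; rewrite in_itv/= andbT.
Qed.

Lemma measurable_le0 : measurable [set x | X x <= 0].
Proof.
rewrite (_ : [set _ | _] = ~` [set x | 0 < X x]).
  exact: measurableC measurable_gt0.
by apply/seteqP; split => x /=; rewrite leNgt => /negP.
Qed.

Lemma probability_le0 : P [set x | X x <= 0] = (1 - P [set x | (0 < X x)%R])%E.
Proof.
rewrite -probability_setC ?measurable_gt0//; last exact: measurable_gt0.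
by congr (P _); apply/seteqP; split => x /=; rewrite leNgt => /negP.
Qed.

(** The squared deviation is nonnegative with zero integral, hence vanishes almost everywhere. *)
Lemma cov_eq0_ae : cov P X X = 0 -> {ae P, forall x, X x = mean P X}.
Proof.
move=> XX0.
have mf : measurable_fun setT (fun x => ((X x - mean P X) ^+ 2)%:E).
  by apply/measurable_EFinP; apply: measurable_funX; exact: measurable_funB.
have : (\int[P]_x `|((X x - mean P X) ^+ 2)%:E| = 0)%E.
  have := varianceE_cov X2; rewrite XX0 /variance unlock (meanE X1) unlock => V0.
  rewrite -[RHS]V0; apply: eq_integral => x _.
  by rewrite /= ger0_norm ?sqr_ge0// expr2.
move/(ae_eq_integral_abs P measurableT mf); apply: filterS => x /(_ I) [] /eqP.
by rewrite sqrf_eq0 subr_eq0 => /eqP.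
Qed.

(** With [lambda] equal to minus the mean [m], Cantelli bounds the probability by
    [s ^+ 2 / (s ^+ 2 + m ^+ 2)]. Since [k ^+ 2 = p / (1 - p)], this is at most [1 - p] as soon as
    [(k * s) ^+ 2 <= m ^+ 2]. *)
Lemma probability_gt0_le p : 0 < p < 1 ->
  Num.sqrt (p / (1 - p)) * Num.sqrt (cov P X X) + mean P X <= 0 ->
  (P [set x | (0 < X x)%R] <= (1 - p)%:E)%E.
Proof.
move=> /andP[p0 p1]; set k := Num.sqrt (p / _); set s := Num.sqrt _ => ksm.
have q0 : 0 < 1 - p by rewrite subr_gt0.
have k0 : 0 < k by rewrite sqrtr_gt0 divr_gt0.
have k2 : k ^+ 2 * (1 - p) = p by rewrite sqr_sqrtr ?divfK ?gt_eqF// divr_ge0 ?ltW.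
have s0 : 0 <= s by exact: sqrtr_ge0.
have s2 : s ^+ 2 = cov P X X by rewrite sqr_sqrtr// cov_ge0.
have ks0 : 0 <= k * s by rewrite mulr_ge0// ltW.
have [m0|m0] := ltP (mean P X) 0.
  have Nm0 : 0 < - mean P X by rewrite oppr_gt0.
  have sub : [set x | 0 < X x] `<=` [set x | - mean P X <= X x - mean P X].
    by move=> x /= Xx; rewrite lerDr ltW.
  apply: le_trans (le_trans (cantelli_mean Nm0) _).
    apply: le_measure => //; rewrite ?inE; first exact: measurable_gt0.
    rewrite (_ : [set x | _ <= X x - mean P X] = X @^-1` `[0, +oo[).
      by rewrite -[X in measurable X]setTI; exact: mX.
    by apply/seteqP; split => x /=; rewrite in_itv/= andbT lerDr.
  have m2 : 0 < mean P X ^+ 2 by rewrite exprn_even_gt0//= lt_eqF.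
  rewrite lee_fin sqrrN ler_pdivrMr ?ltr_wpDl// ?cov_ge0// -s2.
  have : (k * s) ^+ 2 <= (- mean P X) ^+ 2.
    by rewrite ler_sqr ?nnegrE ?(ltW Nm0)//; lra.
  rewrite exprMn sqrrN => /(ler_wpM2r (ltW q0)).
  by rewrite mulrAC k2; lra.
(* Cantelli needs [lambda] positive. When the mean is nonnegative, the hypothesis bounds a sum of
   two nonnegative terms by 0, so both vanish and [X] is almost surely 0. *)
have s_eq0 : s = 0.
  have /eqP : k * s = 0 by lra.
  by rewrite mulf_eq0 gt_eqF//= => /eqP.
have m_eq0 : mean P X = 0 by lra.
have [N [mN N0 XN]] : {ae P, forall x, X x = mean P X}.
  by apply: cov_eq0_ae; rewrite -s2 s_eq0 expr0n.
apply: (@le_trans _ _ (P N)); last by rewrite N0 lee_fin ltW.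
apply: le_measure; rewrite ?inE//; first exact: measurable_gt0.
by move=> x /= Xx; apply: XN => /=; rewrite m_eq0 => X0; rewrite X0 ltxx in Xx.
Qed.

Lemma probability_le0_ge p : 0 < p < 1 ->
  Num.sqrt (p / (1 - p)) * Num.sqrt (cov P X X) + mean P X <= 0 ->
  (p%:E <= P [set x | (X x <= 0)%R])%E.
Proof.
move=> p01 /(probability_gt0_le p01) h; rewrite probability_le0.
have fP : P [set x | (0 < X x)%R] \is a fin_num.
  by rewrite fin_num_measure//; exact: measurable_gt0.
move: h; rewrite -(fineK fP) -EFinB !lee_fin; lra.
Qed.

Lemma probability_le0_eq0 : cov P X X = 0 -> 0 < mean P X ->
  P [set x | X x <= 0] = 0%E.
Proof.
move=> /cov_eq0_ae [N [mN N0 XN]] m0; apply/eqP; rewrite eq_le measure_ge0 andbT.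
rewrite -N0; apply: le_measure; rewrite ?inE//; first exact: measurable_le0.
by move=> x /= Xx; apply: XN => /= X0; move: Xx; rewrite X0 leNgt m0.
Qed.

End one_sided_bounds.

(** * Complex row vectors as real vectors of twice the length *)

Section real_coordinates.
Local Open Scope complex_scope.
Context (R : realType) (N : nat).

(** Indexing by a sum type lets real and imaginary parts be handled by one family of real
    variables. *)
Definition rcoord (a : 'I_N + 'I_N) (d : 'rV[R[i]]_N) : R :=
  match a with inl j => re_coord j d | inr j => im_coord j d end.

Definition of_rcoord (v : 'I_N + 'I_N -> R) : 'rV[R[i]]_N :=
  \row_j (v (inl j) +i* v (inr j)).

Lemma of_rcoordK v a : rcoord a (of_rcoord v) = v a.
Proof. by case: a => j; rewrite /= /re_coord /im_coord mxE. Qed.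

Lemma rcoord_inj d d' : (forall a, rcoord a d = rcoord a d') -> d = d'.
Proof.
move=> dd'; apply/matrixP => k j; rewrite (ord1 k).
have := dd' (inl j); have := dd' (inr j); rewrite /= /re_coord /im_coord.
by case: (d 0 j) => ? ?; case: (d' 0 j) => ? ? /= -> ->.
Qed.

Lemma measurable_rcoord a :
  measurable_fun setT (rcoord a : borelCrow R N -> R).
Proof.
move=> _ B mB; apply: sub_sigma_algebra; case: a => j; exists j => //.
- by left; exists B.
- by right; exists B.
Qed.

(** The coordinate preimages generate the sigma-algebra, so it suffices to test measurability on
    them. *)
Lemma measurable_to_borelCrow d (T : measurableType d)
    (f : T -> borelCrow R N) :
  (forall a, measurable_fun setT (rcoord a \o f)) -> measurable_fun setT f.
Proof.
move=> mf; apply: (@measurability _ _ _ (borelCrow R N) setT f (@coord_sets R N)) => //.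
move=> _ [_ [j _ [[B mB <-]|[B mB <-]]] <-]; rewrite setTI.
- by rewrite -comp_preimage; apply: (mf (inl j)).
- by rewrite -comp_preimage; apply: (mf (inr j)).
Qed.

Definition square_integrable (P : Cdistribution R N) :=
  forall a, (rcoord a : borelCrow R N -> R) \in Lfun P 2%:E.

Implicit Types (P Q : Cdistribution R N) (mu : 'rV[R[i]]_N) (G J : 'M[R[i]]_N).

Lemma rcoord_Cmean P a : rcoord a (Cmean P) = mean P (rcoord a).
Proof. by case: a => j; rewrite /= /re_coord /im_coord mxE. Qed.

(** Expansion of [(x + iy)] times the conjugate of [(u + iv)]. Together with its analogue without
    conjugation, it yields a linear system for the four real covariances. *)
Lemma Ccovariance_rcoord P j k : square_integrable P ->
  Ccovariance P j k =
  (cov P (rcoord (inl j)) (rcoord (inl k)) +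
   cov P (rcoord (inr j)) (rcoord (inr k))) +i*
  (cov P (rcoord (inr j)) (rcoord (inl k)) -
   cov P (rcoord (inl j)) (rcoord (inr k))).
Proof.
move=> P2; have PP a b : (fun d => (rcoord a d - mean P (rcoord a)) *
    (rcoord b d - mean P (rcoord b))) \in Lfun P 1.
  by apply: Lfun2_prod; exact: Lfun2_center.
rewrite mxE /Cexpectation; congr (_ +i* _); last rewrite -[in RHS]mulN1r.
  rewrite /cov -meanD//; apply: eq_mean => d.
  rewrite -!rcoord_Cmean /= /re_coord /im_coord.
  by case: (d 0 j) (d 0 k) (Cmean P 0 j) (Cmean P 0 k) => ? ? [? ?] [? ?] [? ?] /=; ring.
rewrite /cov -meanZ// -meanD//; last exact: LfunZ.
apply: eq_mean => d; rewrite -!rcoord_Cmean /= /re_coord /im_coord.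
by case: (d 0 j) (d 0 k) (Cmean P 0 j) (Cmean P 0 k) => ? ? [? ?] [? ?] [? ?] /=; ring.
Qed.

Lemma Cpseudo_covariance_rcoord P j k : square_integrable P ->
  Cpseudo_covariance P j k =
  (cov P (rcoord (inl j)) (rcoord (inl k)) -
   cov P (rcoord (inr j)) (rcoord (inr k))) +i*
  (cov P (rcoord (inl j)) (rcoord (inr k)) +
   cov P (rcoord (inr j)) (rcoord (inl k))).
Proof.
move=> P2; have PP a b : (fun d => (rcoord a d - mean P (rcoord a)) *
    (rcoord b d - mean P (rcoord b))) \in Lfun P 1.
  by apply: Lfun2_prod; exact: Lfun2_center.
rewrite mxE /Cexpectation; congr (_ +i* _); first rewrite -[in RHS]mulN1r.
  rewrite /cov -meanZ// -meanD//; last exact: LfunZ.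
  apply: eq_mean => d; rewrite -!rcoord_Cmean /= /re_coord /im_coord.
  by case: (d 0 j) (d 0 k) (Cmean P 0 j) (Cmean P 0 k) => ? ? [? ?] [? ?] [? ?] /=; ring.
rewrite /cov -meanD//; apply: eq_mean => d.
rewrite -!rcoord_Cmean /= /re_coord /im_coord.
by case: (d 0 j) (d 0 k) (Cmean P 0 j) (Cmean P 0 k) => ? ? [? ?] [? ?] [? ?] /=; ring.
Qed.

(** Solution of that linear system: half sums and half differences of the entries of [G] and [J]
    recover the real covariance matrix. *)
Definition rcov G J (a b : 'I_N + 'I_N) : R :=
  match a, b with
  | inl j, inl k => (complex.Re (G j k) + complex.Re (J j k)) / 2
  | inr j, inr k => (complex.Re (G j k) - complex.Re (J j k)) / 2
  | inl j, inr k => (complex.Im (J j k) - complex.Im (G j k)) / 2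
  | inr j, inl k => (complex.Im (J j k) + complex.Im (G j k)) / 2
  end.

Lemma distributions_with_moments mu G J P : distributions_with mu G J P ->
  [/\ square_integrable P, forall a, mean P (rcoord a) = rcoord a mu &
      forall a b, cov P (rcoord a) (rcoord b) = rcov G J a b].
Proof.
move=> [P2 <- <- <-]; have {}P2 : square_integrable P.
  by move=> [j|j]; have [] := P2 j.
split=> // [a|[j|j] [k|k]]; rewrite ?rcoord_Cmean//=
  Ccovariance_rcoord// Cpseudo_covariance_rcoord//=; by field.
Qed.

(** Criterion by which the modified law of the worst case is seen to stay in the family. *)
Lemma distributions_with_eq_moments mu G J P Q : distributions_with mu G J P ->
  square_integrable Q ->
  (forall a, mean Q (rcoord a) = mean P (rcoord a)) ->
  (forall a b, cov Q (rcoord a) (rcoord b) = cov P (rcoord a) (rcoord b)) ->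
  distributions_with mu G J Q.
Proof.
move=> PD Q2 Qm Qc; have [P2 _ _] := distributions_with_moments PD.
case: PD => _ <- <- <-; split.
- by move=> j; split; [exact: (Q2 (inl j))|exact: (Q2 (inr j))].
- by apply: rcoord_inj => a; rewrite !rcoord_Cmean.
- by apply/matrixP => j k; rewrite !Ccovariance_rcoord// !Qc.
- by apply/matrixP => j k; rewrite !Cpseudo_covariance_rcoord// !Qc.
Qed.

Definition lincomb (w : 'I_N + 'I_N -> R) (d : 'rV[R[i]]_N) : R :=
  \sum_a w a * rcoord a d.

Lemma Lfun_lincomb P w : square_integrable P ->
  (lincomb w : borelCrow R N -> R) \in Lfun P 2%:E.
Proof.
by move=> P2; apply: Lfun_sum => [|a]; rewrite ?ler1n//; apply: LfunZ; rewrite ?ler1n.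
Qed.

End real_coordinates.

(** * A law with the same moments and a two-point linear functional *)

Section worst_case.
Context (R : realType) (N : nat) (P : Cdistribution R N).
Variables (P2 : square_integrable P) (w : 'I_N + 'I_N -> R).

Let X (a : 'I_N + 'I_N) : borelCrow R N -> R := rcoord a.
Let L : borelCrow R N -> R := lincomb w.
Let psi d := L d - mean P L.
Let v := cov P L L.
Hypothesis v0 : 0 < v.
(** Regression coefficient of [X a] on [L]: the remainder [X a - g a * psi] is uncorrelated with
    [L]. *)
Let g a := cov P (X a) L / v.

Let L2 : L \in Lfun P 2%:E := Lfun_lincomb w P2.
Let Xc2 a : (fun d => X a d - mean P (X a)) \in Lfun P 2%:E.
Proof. exact: Lfun2_center. Qed.
Let psi2 : psi \in Lfun P 2%:E. Proof. exact: Lfun2_center. Qed.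

Let mean_center Y : Y \in Lfun P 1 -> mean P (fun d => Y d - mean P Y) = 0.
Proof. by move=> Y1; rewrite meanD// ?mean_cst ?subrr// Lfun_const. Qed.

(* Keeps the component of [d] uncorrelated with [L d] and replaces [L d] by its
   mean plus [s]. *)
Let move_to s (d : borelCrow R N) : borelCrow R N :=
  of_rcoord (fun a => X a d + g a * (s - psi d)).

Let X_move_to s a d : X a (move_to s d) = X a d + g a * (s - psi d).
Proof. exact: of_rcoordK. Qed.

Let measurable_move_to s : measurable_fun setT (move_to s).
Proof.
apply: measurable_to_borelCrow => a.
rewrite (_ : _ \o _ = fun d => X a d + g a * (s - psi d)); last first.
  by apply/funext => d; exact: X_move_to.
apply: measurable_funD; first exact: measurable_rcoord.
apply: measurable_funM => //; apply: measurable_funB => //.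
exact: Lfun_measurable psi2.
Qed.

(** The weighted sum of the [g a] is [cov P L L / v = 1], so [L] moves by exactly [s - psi d]. *)
Let L_move_to s d : L (move_to s d) = mean P L + s.
Proof.
rewrite /L /lincomb; under eq_bigr do rewrite -/(X _) X_move_to mulrDr mulrA.
rewrite big_split/= -mulr_suml -/(lincomb w d) -/(L d).
under [X in X * _]eq_bigr do rewrite /g mulrA.
rewrite -mulr_suml (_ : \sum_a _ = v).
  by rewrite divff ?gt_eqF// mul1r /psi; ring.
by under eq_bigr do rewrite covC; rewrite -cov_linr.
Qed.

Let moved s : Cdistribution R N :=
  distribution P (mfun_Sub (mem_set (measurable_move_to s))).

Let X_move_to2 s a : X a \o move_to s \in Lfun P 2%:E.
Proof.
rewrite (_ : _ \o _ = fun d => X a d + g a * (s + -1 * psi d)).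
  apply: LfunD; rewrite ?ler1n//; apply: LfunZ; rewrite ?ler1n//.
  apply: LfunD; rewrite ?ler1n//; first exact: Lfun_const.
  by apply: LfunZ; rewrite ?ler1n.
by apply/funext => d; rewrite mulN1r; exact: X_move_to.
Qed.

Let moved2 s : square_integrable (moved s).
Proof.
move=> a; apply: Lfun2_pushforward => //; first exact: measurable_rcoord.
exact: X_move_to2.
Qed.

Let mean_moved s a : mean (moved s) (X a) = mean P (X a) + g a * s.
Proof.
rewrite mean_pushforward//; last 2 first.
- exact: measurable_rcoord.
- exact/Lfun2_Lfun1/X_move_to2.
rewrite (@eq_mean _ _ _ _ _ (fun d => (X a d + g a * s) + - g a * psi d)).
  rewrite meanD ?meanZ ?meanD ?mean_cst ?mean_center ?subrr ?mulr0 ?addr0//;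
  try exact: Lfun_const; try exact: Lfun2_Lfun1.
  - by apply: LfunD => //; [exact/Lfun2_Lfun1/P2|exact: Lfun_const].
  - by apply: LfunZ => //; exact/Lfun2_Lfun1.
by move=> d; rewrite /= X_move_to; ring.
Qed.

(** The moments are centred at the means under [P], because those are the means of the final
    mixture. Each centred coordinate gains [g a * (s - psi)]; as [psi] has mean 0, variance [v] and
    covariance [v * g a] with [X a], only the stated correction survives. *)
Let mean_moved_prod s a b :
  mean (moved s) (fun d => (X a d - mean P (X a)) * (X b d - mean P (X b))) =
  cov P (X a) (X b) + g a * g b * (s ^+ 2 - v).
Proof.
pose Y c d := X c d - mean P (X c).
have YY c e : (fun d => Y c d * Y e d) \in Lfun P 1 by apply: Lfun2_prod; exact: Xc2.
have Ypsi c : (fun d => Y c d * psi d) \in Lfun P 1 by apply: Lfun2_prod => //; exact: Xc2.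
have psipsi : (fun d => psi d * psi d) \in Lfun P 1 by exact: Lfun2_prod.
have Y1 c : Y c \in Lfun P 1 by exact/Lfun2_Lfun1/Xc2.
have psi1 : psi \in Lfun P 1 by exact: Lfun2_Lfun1.
have mY c : mean P (Y c) = 0 by apply/mean_center/Lfun2_Lfun1/P2.
have mpsi : mean P psi = 0 by exact/mean_center/Lfun2_Lfun1.
have mYpsi c : mean P (fun d => Y c d * psi d) = v * g c.
  by rewrite /g mulrC divfK ?gt_eqF.
rewrite mean_pushforward//; last 2 first.
- by apply: measurable_funM; apply: measurable_funB => //; exact: measurable_rcoord.
- apply: Lfun2_prod.
  + by have := X_move_to2 s a; exact: Lfun2_center.
  + by have := X_move_to2 s b; exact: Lfun2_center.
(* The expanded product is integrated one term at a time; each use of [axpy] carries both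
   integrability and the mean to a longer sum. *)
have axpy c U V : U \in Lfun P 1 -> V \in Lfun P 1 ->
    (fun d => c * U d + V d) \in Lfun P 1 /\
    mean P (fun d => c * U d + V d) = c * mean P U + mean P V.
  move=> U1 V1; have cU1 : (fun d => c * U d) \in Lfun P 1 by exact: LfunZ.
  by split; [exact: LfunD|rewrite meanD// meanZ].
have [F1 mF1] := axpy (- (2 * s * g a * g b)) _ _ psi1 (Lfun_const P 1 (g a * g b * s ^+ 2)).
have [F2 mF2] := axpy (g a * g b) _ _ psipsi F1.
have [F3 mF3] := axpy (- g a) _ _ (Ypsi b) F2.
have [F4 mF4] := axpy (- g b) _ _ (Ypsi a) F3.
have [F5 mF5] := axpy (s * g a) _ _ (Y1 b) F4.
have [F6 mF6] := axpy (s * g b) _ _ (Y1 a) F5.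
have [_ mF7] := axpy 1 _ _ (YY a b) F6.
apply: etrans (etrans _ mF7) _.
  by apply: eq_mean => d; rewrite /= !X_move_to /Y; ring.
rewrite mF6 mF5 mF4 mF3 mF2 mF1 mean_cst !mY mpsi !mYpsi.
rewrite (_ : mean P (fun d => psi d * psi d) = v)//.
rewrite (_ : mean P (fun d => Y a d * Y b d) = cov P (X a) (X b))//; ring.
Qed.

(** The corrections in [mean_moved] and [mean_moved_prod] are affine in [s] and in [s ^+ 2]. They
    cancel on average when [s] is drawn with mean 0 and variance [v]. *)
Lemma worst_case_distribution t : 0 < t -> exists Q : Cdistribution R N,
  [/\ square_integrable Q,
      forall a, mean Q (rcoord a) = mean P (rcoord a),
      forall a b, cov Q (rcoord a) (rcoord b) = cov P (rcoord a) (rcoord b) &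
      0 < mean P (lincomb w) + Num.sqrt (cov P (lincomb w) (lincomb w)) * t ->
      (Q [set d | (lincomb w d <= 0)%R] <= (t ^+ 2 / (1 + t ^+ 2))%:E)%E].
Proof.
move=> t0; pose q := t ^+ 2 / (1 + t ^+ 2); pose sigma := Num.sqrt v.
have sigma2 : sigma ^+ 2 = v by rewrite sqr_sqrtr// ltW.
have t1 : 0 < 1 + t ^+ 2 by rewrite ltr_pwDl// sqr_ge0.
have q01 : 0 <= q <= 1.
  by rewrite divr_ge0 ?sqr_ge0 ?(ltW t1)//= ler_pdivrMr// mul1r lerDr.
(* The two-point variable with values [s1] (probability [q]) and [s2] has mean 0 by [qs] and
   variance [v] by [qs2]. *)
pose s1 := - (sigma / t); pose s2 := sigma * t.
have qs : q * s1 + (1 - q) * s2 = 0.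
  by rewrite /q /s1 /s2; field; rewrite ?gt_eqF.
have qs2 : q * s1 ^+ 2 + (1 - q) * s2 ^+ 2 = v.
  by rewrite -sigma2 /q /s1 /s2; field; rewrite ?gt_eqF.
pose Q : Cdistribution R N := mixture q01 (moved s1) (moved s2).
have Q2 : square_integrable Q by move=> a; apply: Lfun2_mixture; exact: moved2.
have Qm a : mean Q (rcoord a) = mean P (rcoord a).
  rewrite mean_mixture; try by apply: Lfun2_Lfun1; exact: moved2.
  rewrite !mean_moved -[RHS]addr0 -[in RHS](mulr0 (g a)) -qs; ring.
exists Q; split=> // [a b|Ls2].
  rewrite {1}/cov !Qm mean_mixture; try by apply: Lfun2_prod; apply: Lfun2_center; exact: moved2.
  rewrite !mean_moved_prod.
  have -> x y : q * (x + y * (s1 ^+ 2 - v)) + (1 - q) * (x + y * (s2 ^+ 2 - v)) =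
    x + y * (q * s1 ^+ 2 + (1 - q) * s2 ^+ 2 - v) by ring.
  by rewrite qs2 subrr mulr0 addr0.
(* On the upper branch the functional is constant and positive, so the event is null there; on the
   lower branch its probability is bounded by 1, leaving the weight [q]. *)
rewrite [leLHS]mixtureE (_ : moved s2 _ = 0%E) ?mule0 ?adde0.
  rewrite -[leRHS]mule1; apply: lee_wpmul2l; first by rewrite lee_fin; have /andP[] := q01.
  apply: probability_le1; exact: measurable_le0 (Lfun_lincomb w (moved2 s1)).
rewrite -(measure0 P) /= /distribution /pushforward/=; congr (P _).
apply/seteqP; split => d //=; rewrite -/(L _) L_move_to leNgt => /negP; apply.
exact: Ls2.
Qed.

End worst_case.

(** * The second-order cone form *)

Section soc.
Context (R : realType) (n : nat).
Local Notation I := ('I_(n + 1) + 'I_(n + 1))%type.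
Implicit Types (z : 'cV[R[i]]_n) (l : I -> R).

(** The sign comes from the real part of a product without conjugation:
    [Re x * Re y - Im x * Im y]. *)
Definition zweight z (a : I) : R :=
  match a with
  | inl j => complex.Re (ztilde z j 0)
  | inr j => - complex.Im (ztilde z j 0)
  end.

Lemma phiE z d : phi z d = lincomb (zweight z) d.
Proof.
rewrite /phi mxE raddf_sum /lincomb big_sumType/= -big_split/=.
apply: eq_bigr => j _; rewrite /re_coord /im_coord.
by case: (d 0 j) (ztilde z j 0) => ? ? [? ?] /=; ring.
Qed.

(** Linear part, in the real and imaginary parts of [z], of the pairing of [zweight z] with [l]. The
    last entry of [ztilde z] is the real number 1, so it contributes only the constant
    [l (inl (rshift n 0))]. *)
Definition affine_coef l : 'cV[R]_(n + n) :=
  col_mx (\col_j l (inl (lshift 1 j))) (\col_j - l (inr (lshift 1 j))).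

Lemma zweight_affine z l : \sum_a zweight z a * l a =
  ((affine_coef l)^T *m realify z) 0 0 + l (inl (rshift n 0)).
Proof.
rewrite big_sumType/= !big_split_ord/= !big_ord1.
rewrite [X in _ = X + _]mxE big_split_ord/=.
rewrite /ztilde !col_mxEd !mxE /= mul1r oppr0 mul0r addr0 addrAC.
congr (_ + _ + _); apply: eq_bigr => j _.
  by rewrite [X in _ = X * _]mxE !col_mxEu !mxE mulrC.
by rewrite [X in _ = X * _]mxE col_mxEu !col_mxEd !mxE; ring.
Qed.

Lemma soc_constraint_affine (k : R) (S : I -> I -> R) (m : I -> R) : 0 <= k ->
  (forall a b, S a b = S b a) -> (forall w, 0 <= qform S w) ->
  is_soc_constraint (fun z =>
    k * Num.sqrt (qform S (zweight z)) + \sum_a zweight z a * m a).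
Proof.
move=> k0 Ssym Spsd; have [s sE] := psd_sum_squares Ssym Spsd.
(* The default value [m] is never reached, since [i] stays below [size s]. *)
pose l (i : 'I_(size s)) := nth m s i.
exists (size s), (\matrix_(i, j) (k * affine_coef (l i) j 0)).
exists (\col_i (k * l i (inl (rshift n 0)))).
(* The cone form subtracts its affine part, hence the signs; [k] enters the norm by scaling every
   row. *)
exists (- affine_coef m), (- m (inl (rshift n 0))) => z.
rewrite zweight_affine linearN mulNmx [in RHS]mxE -opprD opprK; congr (_ + _).
rewrite sE /l2norm -[in LHS](ger0_norm k0) -sqrtr_sqr -sqrtrM ?sqr_ge0//.
congr Num.sqrt; rewrite (big_nth m) big_mkord mulr_sumr.
apply: eq_bigr => i _; rewrite -exprMn zweight_affine; congr (_ ^+ 2).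
rewrite !mxE mulrDr; congr (_ + _); rewrite mulr_sumr.
by apply: eq_bigr => j _; rewrite !mxE mulrA.
Qed.

End soc.

(** * Equivalence of the robust constraint with the deterministic one *)

Section robust.
Context (R : realType) (n : nat).
Implicit Types (mu : 'rV[R[i]]_(n + 1)) (G J : 'M[R[i]]_(n + 1))
  (z : 'cV[R[i]]_n) (P : Cdistribution R (n + 1)).

Lemma phi_moments mu G J z P : distributions_with mu G J P ->
  [/\ (phi z : borelCrow R (n + 1) -> R) \in Lfun P 2%:E,
      mean P (phi z) = phi z mu &
      cov P (phi z) (phi z) = qform (rcov G J) (zweight z)].
Proof.
move=> /distributions_with_moments[P2 Pm Pc].
rewrite (_ : phi z = lincomb (zweight z)); last by apply/funext => d; exact: phiE.
split; first exact: Lfun_lincomb.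
- rewrite /lincomb mean_lin => [|a]; last exact/Lfun2_Lfun1/P2.
  by apply: eq_bigr => a _; rewrite Pm.
- rewrite /lincomb cov_lin//; apply: eq_bigr => a _.
  by apply: eq_bigr => b _; rewrite Pc.
Qed.

(** Symmetry, like positivity below, is inherited from the real covariance of any member of the
    family; this is one place where nonemptiness enters. *)
Lemma rcov_sym mu G J P a b : distributions_with mu G J P ->
  rcov G J a b = rcov G J b a.
Proof. by move=> /distributions_with_moments[_ _ Pc]; rewrite -!Pc covC. Qed.

Lemma rcov_psd mu G J P w : distributions_with mu G J P ->
  0 <= qform (rcov G J) w.
Proof.
move=> /distributions_with_moments[P2 _ Pc].
rewrite (_ : qform _ _ = cov P (lincomb w) (lincomb w)) ?cov_ge0//.
rewrite /lincomb cov_lin//; apply: eq_bigr => a _.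
by apply: eq_bigr => b _; rewrite Pc.
Qed.

Lemma robust_chance_constraintP mu G J p z :
  distributions_with mu G J !=set0 -> 0 < p < 1 ->
  robust_chance_constraint mu G J p z <->
  kfactor p * Num.sqrt (qform (rcov G J) (zweight z)) + phi z mu <= 0.
Proof.
move=> [P PD] p01; have /andP[p0 p1] := p01.
set sigma := Num.sqrt _; set k := kfactor p; split=> [robust|ksm]; last first.
  apply: le_ereal_inf_tmp => _ [Q QD <-].
  have [phi2 phim phic] := phi_moments z QD.
  by apply: (probability_le0_ge phi2 p01); rewrite phim phic.
have {}robust Q : distributions_with mu G J Q ->
    (p%:E <= Q [set d | (phi z d <= 0)%R])%E.
  by move=> QD; apply: (le_trans robust); apply: ereal_inf_lbound; exists Q.
rewrite leNgt; apply/negP => ksm.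
have [phi2 phim phic] := phi_moments z PD.
have s0 : 0 <= sigma by exact: sqrtr_ge0.
have s2 : sigma ^+ 2 = cov P (phi z) (phi z).
  by rewrite phic sqr_sqrtr// (rcov_psd _ PD).
have := s0; rewrite le_eqVlt => /predU1P[sE|s_gt0].
  have := robust P PD; rewrite (probability_le0_eq0 phi2).
  - by rewrite lee_fin leNgt p0.
  - by rewrite -s2 -sE expr0n.
  - by rewrite phim; move: ksm; rewrite -sE mulr0 add0r.
have q0 : 0 < 1 - p by rewrite subr_gt0.
have k0 : 0 < k by rewrite sqrtr_gt0 divr_gt0.
have k2 : k ^+ 2 = p / (1 - p) by rewrite sqr_sqrtr// divr_ge0 ?ltW.
(* For a nonnegative mean any [t] in the open interval from 0 to [k] works. Otherwise [t] is the
   midpoint between [- phi z mu / sigma] and [k], an interval that is nonempty by [ksm]. *)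
have [t [t0 tk st]] : exists t, [/\ 0 < t, t < k & 0 < phi z mu + sigma * t].
  have [m0|m0] := leP 0 (phi z mu).
    exists (k / 2); split; rewrite ?divr_gt0//; first by lra.
    by rewrite ltr_wpDl// mulr_gt0// divr_gt0.
  exists ((k - phi z mu / sigma) / 2); split.
  - by rewrite divr_gt0// addr_gt0// -mulNr divr_gt0// oppr_gt0.
  - suff : - (phi z mu / sigma) < k by lra.
    by rewrite -mulNr ltr_pdivrMr//; lra.
  - rewrite (_ : _ + _ = (k * sigma + phi z mu) / 2) ?divr_gt0//.
    by field; rewrite gt_eqF.
have [P2 _ _] := distributions_with_moments PD.
have phiL : phi z = lincomb (zweight z) by apply/funext => d; exact: phiE.
have v0 : 0 < cov P (lincomb (zweight z)) (lincomb (zweight z)).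
  by rewrite -phiL -s2 exprn_gt0.
have [Q [Q2 Qm Qc]] := worst_case_distribution P2 v0 t0.
rewrite -phiL -s2 sqrtr_sqr ger0_norm// phim => /(_ st) Qle.
have := le_trans (robust Q (distributions_with_eq_moments PD Q2 Qm Qc)) Qle.
have t1 : 0 < 1 + t ^+ 2 by rewrite ltr_pwDl// sqr_ge0.
rewrite lee_fin ler_pdivlMr// leNgt => /negP; apply.
(* This is [t < k] squared, and it rearranges to [t ^+ 2 / (1 + t ^+ 2) < p]. *)
have : t ^+ 2 * (1 - p) < p.
  by rewrite -ltr_pdivlMr// -k2 ltr_sqr ?nnegrE ?ltW.
lra.
Qed.

End robust.

Theorem theorem5p1 (R : realType) (m n : nat)
    (mu : 'I_m -> 'rV[R[i]]_(n + 1)) (Gamma J : 'I_m -> 'M[R[i]]_(n + 1))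
    (nonempty : forall i, distributions_with (mu i) (Gamma i) (J i) !=set0) :
  exists mu_phi sigma_phi : 'I_m -> 'cV[R[i]]_n -> R,
    (forall i z, 0 <= sigma_phi i z) /\
    (forall i z (P : Cdistribution R (n + 1)),
       distributions_with (mu i) (Gamma i) (J i) P ->
       ('E_P[phi z] = (mu_phi i z)%:E /\
        variance P (phi z) = (sigma_phi i z ^+ 2)%:E)%E) /\
    forall p : 'I_m -> R, (forall i, 0 < p i < 1) ->
      (forall z i,
         robust_chance_constraint (mu i) (Gamma i) (J i) (p i) z <->
         kfactor (p i) * sigma_phi i z + mu_phi i z <= 0) /\
      (forall i,
         is_soc_constraint
           (fun z => kfactor (p i) * sigma_phi i z + mu_phi i z)).
Proof.
(* By linearity, the mean of [phi z] is its value at the prescribed mean. *)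
exists (fun i z => phi z (mu i)).
exists (fun i z => Num.sqrt (qform (rcov (Gamma i) (J i)) (zweight z))).
split; [|split].
- by move=> i z; exact: sqrtr_ge0.
- move=> i z P PD; have [phi2 <- phic] := phi_moments z PD.
  rewrite (meanE (Lfun2_Lfun1 phi2)) (varianceE_cov phi2) phic.
  by rewrite sqr_sqrtr// (rcov_psd _ PD).
- move=> p p01; split=> [z i|i]; first exact: robust_chance_constraintP.
  have [P PD] := nonempty i.
  (* The mean is the pairing of [zweight z] with the real coordinates of [mu i], so it has the
     required affine form. *)
  have [r [M [q [f [c soc]]]]] := soc_constraint_affine
    (fun a => rcoord a (mu i)) (sqrtr_ge0 (p i / (1 - p i)))
    (fun a b => rcov_sym a b PD) (fun w => rcov_psd w PD).
  by exists r, M, q, f, c => z; rewrite -soc [phi z (mu i)]phiE.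
Qed.
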